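(* A given $q=(q^{1,c},q^{1,p},\ldots,q^{r,c},q^{r,p})\in(\mathcal{M}_1(\mathcal{Z}))^{2r}$ is a fixed point of the McKean-Vlasov system $\dot\mu_j^\iota(t)=\mu_j^\iota(t)A^{j,\iota}_{\mu(t)}$ ($1\le j\le r$, $\iota\in\{c,p\}$), i.e. $q^{j,\iota}A^{j,\iota}_q=0$ for all $1\le j\le r$ and $\iota\in\{c,p\}$, if and only if $q\in(\mathcal{S}^\circ)^{2r}$ and the directional derivative $\frac{\partial}{\partial v}F(q)$ equals $0$ for all $v\in\mathcal{H}^0$.
   Context: $\mathcal{Z}=\{1,\ldots,K\}$ is a finite set; $\mathcal{M}_1(\mathcal{Z})$, the set of probability measures on $\mathcal{Z}$ (row vectors), is identified with the simplex $\mathcal{S}=\{p\in\mathbb{R}^K:p_z\ge0,\ \sum_zp_z=1\}$, and $\mathcal{S}^\circ=\{p\in\mathcal{S}:p_z>0\ \forall z\in\mathcal{Z}\}$. Parameters: $r$ is a positive integer; $\alpha_j,p_j^c,p_j^p\in(0,1)$ for $1\le j\le r$ with $p_j^c+p_j^p=1$ and $\sum_j\alpha_j=1$; $\beta>0$; $W:\mathcal{Z}\times\mathcal{Z}\to\mathbb{R}$ is symmetric. $\mathcal{E}\subset\mathcal{Z}\times\mathcal{Z}\setminus\{(z,z):z\in\mathcal{Z}\}$ is symmetric with $(\mathcal{Z},\mathcal{E})$ irreducible, and $a(z,z')=1$ if $(z,z')\in\mathcal{E}$, $a(z,z')=0$ otherwise. **Rate matrices.** For $q\in(\mathcal{M}_1(\mathcal{Z}))^{2r}$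 let $$\psi^{j,c}(z,z',q)=\beta\sum_{x\in\mathcal{Z}}(W(x,z')-W(x,z))\big(\alpha_jp_j^cq_x^{j,c}+\alpha_jp_j^pq_x^{j,p}\big),$$ $$\psi^{j,p}(z,z',q)=\beta\sum_{x\in\mathcal{Z}}(W(x,z')-W(x,z))\Big(\alpha_jp_j^cq_x^{j,c}+\sum_{l=1}^r\alpha_lp_l^pq_x^{l,p}\Big),$$ and for $\iota\in\{c,p\}$ let $\lambda^{j,\iota}_{z,z'}(q)=e^{-(\psi^{j,\iota}(z,z',q))^+}a(z,z')$ for $z\ne z'$, $\lambda^{j,\iota}_{z,z}(q)=-\sum_{z'\ne z}\lambda^{j,\iota}_{z,z'}(q)$, $A^{j,\iota}_q=(\lambda^{j,\iota}_{z,z'}(q))_{z,z'\in\mathcal{Z}}$. Here $u^+=\max(u,0)$. **The function $F$.** With $C\in\mathbb{R}$ a constant not depending on $q$, $$\begin{aligned}F(q)=&\sum_{j=1}^r\frac{\beta}{2}\bigg\{(\alpha_jp_j^c)^2\sum_{z,z'\in\mathcal{Z}}W(z,z')q_{z'}^{j,c}q_z^{j,c}+2\alpha_j^2p_j^pp_j^c\sum_{z,z'\in\mathcal{Z}}W(z,z')q_{z'}^{j,p}q_z^{j,c}\\&\qquad+\alpha_jp_j^p\sum_{k=1}^r\alpha_kp_k^p\sum_{z,z'\in\mathcal{Z}}W(z,z')q_{z'}^{k,p}q_z^{j,p}\bigg\}\\&+\sum_{j=1}^r\Big(\alpha_jp_j^c\sum_{z\in\mathcal{Z}}q_z^{j,c}\log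 q_z^{j,c}+\alpha_jp_j^p\sum_{z\in\mathcal{Z}}q_z^{j,p}\log q_z^{j,p}\Big)+C.\end{aligned}$$ **Directional derivative.** $\mathcal{H}^0=\{v\in(\mathbb{R}^K)^{2r}:\sum_{x=1}^Kv_x^{j,\iota}=0\text{ for all }1\le j\le r,\ \iota\in\{c,p\}\}$, and $\frac{\partial}{\partial v}F(q)=\sum_{j=1}^r\sum_{\iota\in\{c,p\}}\sum_{x\in\mathcal{Z}}\frac{\partial F(q)}{\partial q_x^{j,\iota}}v_x^{j,\iota}$. *)

(* Defs.v *)
From HB Require Import structures.
From mathcomp Require Import all_boot all_order all_algebra.
From mathcomp Require Import all_classical all_reals all_analysis.

Set Implicit Arguments.
Unset Strict Implicit.
Unset Printing Implicit Defensive.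

Import Order.TTheory GRing.Theory Num.Theory.
Import numFieldNormedType.Exports.

Local Open Scope ring_scope.

(* The superscript iota in {c, p}: central and peripheral nodes. *)
Variant kind := cen | per.

Definition bool_of_kind (i : kind) : bool := if i is cen then true else false.
Definition kind_of_bool (b : bool) : kind := if b then cen else per.
Lemma bool_of_kindK : cancel bool_of_kind kind_of_bool.
Proof. by case. Qed.
HB.instance Definition _ := Finite.copy kind (can_type bool_of_kindK).

Section Model.
Context {R : realType} {K r : nat}.

(* (R^K)^(2r), the set Z = {1, ..., K} being 'I_K;
   the coordinate q_x^{j,iota} is q j iota 0 x. *)
Definition state := 'I_r -> kind -> 'rV[R]_K.

Definition in_simplex (m : 'rV[R]_K) : Prop :=
  (forall z, 0 <= m 0 z) /\ \sum_(z < K) m 0 z = 1.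

Definition in_simplex_interior (m : 'rV[R]_K) : Prop :=
  in_simplex m /\ forall z, 0 < m 0 z.

Definition in_H0 (v : state) : Prop :=
  forall j i, \sum_(x < K) v j i 0 x = 0.

Definition irreducible_graph (E : rel 'I_K) : Prop :=
  forall z z', connect E z z'.

Definition adj (E : rel 'I_K) (z z' : 'I_K) : R := if E z z' then 1 else 0.

Definition psi (alpha : 'I_r -> R) (p : 'I_r -> kind -> R) (beta : R)
    (W : 'I_K -> 'I_K -> R) (j : 'I_r) (i : kind) (z z' : 'I_K) (q : state) : R :=
  match i with
  | cen => beta * \sum_(x < K) (W x z' - W x z) *
             (alpha j * p j cen * q j cen 0 x + alpha j * p j per * q j per 0 x)
  | per => beta * \sum_(x < K) (W x z' - W x z) *
             (alpha j * p j cen * q j cen 0 x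
              + \sum_(l < r) alpha l * p l per * q l per 0 x)
  end.

Definition offdiag_rate (alpha : 'I_r -> R) (p : 'I_r -> kind -> R) (beta : R)
    (W : 'I_K -> 'I_K -> R) (E : rel 'I_K)
    (j : 'I_r) (i : kind) (q : state) (z z' : 'I_K) : R :=
  expR (- Num.max (psi alpha p beta W j i z z' q) 0) * adj E z z'.

Definition rate_matrix (alpha : 'I_r -> R) (p : 'I_r -> kind -> R) (beta : R)
    (W : 'I_K -> 'I_K -> R) (E : rel 'I_K)
    (j : 'I_r) (i : kind) (q : state) : 'M[R]_K :=
  \matrix_(z, z')
    if z == z' then - \sum_(y < K | y != z) offdiag_rate alpha p beta W E j i q z y
    else offdiag_rate alpha p beta W E j i q z z'.

Definition fixed_point (alpha : 'I_r -> R) (p : 'I_r -> kind -> R) (beta : R)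
    (W : 'I_K -> 'I_K -> R) (E : rel 'I_K) (q : state) : Prop :=
  forall j i, q j i *m rate_matrix alpha p beta W E j i q = 0.

(* On the boundary of the simplex, 0 log 0 = 0 since ln 0 = 0. *)
Definition freeF (alpha : 'I_r -> R) (p : 'I_r -> kind -> R) (beta : R)
    (W : 'I_K -> 'I_K -> R) (C : R) (q : state) : R :=
  \sum_(j < r) beta / 2 *
    ((alpha j * p j cen) ^+ 2 *
       (\sum_(z < K) \sum_(z' < K) W z z' * q j cen 0 z' * q j cen 0 z)
     + 2 * (alpha j) ^+ 2 * p j per * p j cen *
       (\sum_(z < K) \sum_(z' < K) W z z' * q j per 0 z' * q j cen 0 z)
     + alpha j * p j per *
       (\sum_(k < r) alpha k * p k per *
          (\sum_(z < K) \sum_(z' < K) W z z' * q k per 0 z' * q j per 0 z)))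
  + \sum_(j < r)
      (alpha j * p j cen * (\sum_(z < K) q j cen 0 z * ln (q j cen 0 z))
       + alpha j * p j per * (\sum_(z < K) q j per 0 z * ln (q j per 0 z)))
  + C.

Definition set_coord (q : state) (j : 'I_r) (i : kind) (x : 'I_K) (t : R) : state :=
  fun j' i' => \row_x'
    if [&& j' == j, i' == i & x' == x] then t else q j' i' 0 x'.

Definition partial (f : state -> R) (j : 'I_r) (i : kind) (x : 'I_K) (q : state) : R :=
  derive1 (fun t : R => f (set_coord q j i x t)) (q j i 0 x).

Definition dir_deriv (f : state -> R) (v q : state) : R :=
  \sum_(j < r) \sum_(i : kind) \sum_(x < K) partial f j i x q * v j i 0 x.

End Model.

Arguments state : clear implicits.

(* Main.v *)
Require Import Defs.
From mathcomp Require Import all_boot all_order all_algebra.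
From mathcomp Require Import all_classical all_reals all_analysis.
From mathcomp Require Import ring.

Set Implicit Arguments.
Unset Strict Implicit.
Unset Printing Implicit Defensive.

Import Order.TTheory GRing.Theory Num.Theory.
Import numFieldNormedType.Exports.

Local Open Scope ring_scope.

(* The rates are reversible with respect to the weights exp(-U), where U^{j,iota} is the
   potential with psi(z,z') = U(z') - U(z).  Hence q^{j,iota} A = 0 says that the density
   w = q^{j,iota} exp(U^{j,iota}) is harmonic for a symmetric weighted Laplacian on the
   connected graph (Z,E), i.e. that w is constant.  As
   dF/dq_x^{j,iota} = alpha_j p_j^iota (log w_x + 1), the same constancy expresses that the
   gradient of F is orthogonal to H^0. *)

(** * Harmonic functions on a connected weighted graph *)

Section Laplacian.
Context {R : realType} {K : nat}.
Implicit Types (S : 'I_K -> 'I_K -> R) (w : 'I_K -> R) (E : rel 'I_K).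

Lemma connect_const E w : irreducible_graph E ->
  (forall z z', E z z' -> w z = w z') -> forall z z', w z = w z'.
Proof.
move=> Eirr wE z z'; have /connectP[s] := Eirr z z'.
elim: s z => [z _ -> //|y s IHs z /= /andP[Ezy ys] z'E].
by rewrite (wE _ _ Ezy) (IHs y).
Qed.

Lemma harmonic_const S w E : (forall z z', 0 <= S z z') ->
  (forall z z', S z z' = S z' z) -> (forall z z', E z z' -> 0 < S z z') ->
  irreducible_graph E ->
  (forall z', \sum_z S z z' * (w z - w z') = 0) -> forall z z', w z = w z'.
Proof.
move=> S_ge0 Ssym SE Eirr harm; apply: connect_const Eirr _ => z z' Ezz'.
(* Pairing the Laplacian of [w] with [w] gives its Dirichlet energy. *)
have pair0 : \sum_z' \sum_z w z' * (S z z' * (w z - w z')) = 0.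
  by apply: big1 => y _; rewrite -mulr_sumr harm mulr0.
have energy0 : \sum_z' \sum_z S z z' * (w z - w z') ^+ 2 = 0.
  (* By symmetry of [S], the energy is the sum of two copies of the pairing (up to sign) that differ
     by exchanging the two indices. *)
  transitivity (\sum_z' \sum_z - (w z * (S z' z * (w z' - w z)))
                - \sum_z' \sum_z w z' * (S z z' * (w z - w z'))).
    rewrite -sumrB; apply: eq_bigr => y _; rewrite -sumrB.
    by apply: eq_bigr => x _; rewrite (Ssym y x); ring.
  rewrite pair0 subr0 exchange_big /=; under eq_bigr do rewrite sumrN.
  by rewrite sumrN pair0 oppr0.
have term_ge0 y x : 0 <= S x y * (w x - w y) ^+ 2.
  by rewrite mulr_ge0 ?sqr_ge0.
have row0 := psumr_eq0P (fun y _ => sumr_ge0 _ (fun x _ => term_ge0 y x)) energy0.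
have /eqP := psumr_eq0P (fun x _ => term_ge0 z' x) (row0 z' isT) (i := z) isT.
by rewrite mulf_eq0 gt_eqF ?SE //= sqrf_eq0 subr_eq0 => /eqP.
Qed.

End Laplacian.

(** * Differentiation rules, written for explicit abstractions so that they compose along the
    formula of [freeF] *)

Section RealDerivatives.
Context {R : realType}.
Implicit Types (f g : R -> R) (t : R).

Lemma is_derive_fsum n (h : 'I_n -> R -> R) (dh : 'I_n -> R) t :
  (forall i, is_derive t 1 (h i) (dh i)) ->
  is_derive t 1 (fun s => \sum_(i < n) h i s) (\sum_(i < n) dh i).
Proof.
move=> hd; rewrite [X in is_derive _ _ X _](_ : _ = \sum_(i < n) h i).
  exact: is_derive_sum.
by apply/funext => s; rewrite fct_sumE.
Qed.

Lemma is_derive_fadd f g t df dg : is_derive t 1 f df -> is_derive t 1 g dg ->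
  is_derive t 1 (fun s => f s + g s) (df + dg).
Proof. by move=> fd gd; exact: (is_deriveD fd gd). Qed.

Lemma is_derive_fmul f g t df dg : is_derive t 1 f df -> is_derive t 1 g dg ->
  is_derive t 1 (fun s => f s * g s) (df * g t + f t * dg).
Proof.
move=> fd gd; apply: (is_derive_eq (is_deriveM fd gd)).
by rewrite addrC mulrC.
Qed.

Lemma is_derive_scale f t df (c : R) : is_derive t 1 f df ->
  is_derive t 1 (fun s => c * f s) (c * df).
Proof. by move=> fd; exact: (is_deriveZ c fd). Qed.

Lemma is_derive_xlnx f t df : is_derive t 1 f df -> 0 < f t ->
  is_derive t 1 (fun s => f s * ln (f s)) ((ln (f t) + 1) * df).
Proof.
move=> fd ft_gt0; have lnd := is_derive1_ln ft_gt0.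
apply: (is_derive_eq (is_derive_fmul fd (is_derive1_comp (f := @ln R) lnd fd))).
by rewrite mulrA divff ?gt_eqF //=; ring.
Qed.

End RealDerivatives.

Lemma big_kind (V : nmodType) (f : kind -> V) :
  \sum_(i : kind) f i = f cen + f per.
Proof.
rewrite (reindex kind_of_bool); first by rewrite big_bool.
by exists bool_of_kind => [[]|[]].
Qed.

(** * The bilinear form of the interaction [W] *)

Section Bilinear.
Context {R : realType} {K : nat} (W : 'I_K -> 'I_K -> R).
Implicit Types (u v : 'I_K -> R).

(** The first argument carries the second index of [W], so that the double sums of [freeF] are
    instances by conversion. *)
Definition bilin u v := \sum_(z < K) \sum_(z' < K) W z z' * u z' * v z.

Lemma bilinC u v : (forall z z', W z z' = W z' z) -> bilin u v = bilin v u.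
Proof.
move=> hW; rewrite /bilin exchange_big; apply: eq_bigr => z _.
by apply: eq_bigr => z' _; rewrite hW mulrAC.
Qed.

Lemma bilinDl u1 u2 v : bilin (u1 \+ u2) v = bilin u1 v + bilin u2 v.
Proof.
rewrite /bilin -big_split; apply: eq_bigr => z _; rewrite -big_split.
by apply: eq_bigr => z' _ /=; ring.
Qed.

Lemma bilinZl (c : R) u v : bilin (fun x => c * u x) v = c * bilin u v.
Proof.
rewrite /bilin mulr_sumr; apply: eq_bigr => z _; rewrite mulr_sumr.
by apply: eq_bigr => z' _ /=; ring.
Qed.

Lemma bilin_suml n (u : 'I_n -> 'I_K -> R) v :
  bilin (fun x => \sum_(k < n) u k x) v = \sum_(k < n) bilin (u k) v.
Proof.
rewrite /bilin [RHS]exchange_big; apply: eq_bigr => z _; rewrite [RHS]exchange_big.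
by apply: eq_bigr => z' _ /=; rewrite mulr_sumr mulr_suml.
Qed.

Lemma is_derive_bilin (u v : R -> 'I_K -> R) (t : R) du dv :
  (forall z, is_derive t 1 (u ^~ z) (du z)) ->
  (forall z, is_derive t 1 (v ^~ z) (dv z)) ->
  is_derive t 1 (fun s => bilin (u s) (v s)) (bilin du (v t) + bilin (u t) dv).
Proof.
move=> ud vd; rewrite /bilin -big_split /=; apply: is_derive_fsum => z.
rewrite -big_split /=; apply: is_derive_fsum => z'.
by apply: is_derive_fmul => //; exact: is_derive_scale.
Qed.

End Bilinear.

(** * Reversibility of the rates and the fixed points *)

Section MeanField.
Context {R : realType} {K r : nat}.
Variables (alpha : 'I_r -> R) (p : 'I_r -> kind -> R) (beta : R).
Variables (W : 'I_K -> 'I_K -> R) (E : rel 'I_K).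
Implicit Types (q v : state R K r) (j : 'I_r) (i : kind).

(** The weighted occupation measure felt by nodes of type [(j, i)]. It enters both [psi] and the
    gradient of the quadratic part of [freeF]. *)
Definition field j i q (x : 'I_K) : R :=
  match i with
  | cen => alpha j * p j cen * q j cen 0 x + alpha j * p j per * q j per 0 x
  | per => alpha j * p j cen * q j cen 0 x
           + \sum_(l < r) alpha l * p l per * q l per 0 x
  end.

Definition potential j i q (z : 'I_K) : R :=
  beta * \sum_(x < K) W x z * field j i q x.

Definition gibbs_ratio j i q (z : 'I_K) : R := q j i 0 z * expR (potential j i q z).

Lemma psiE j i q z z' :
  psi alpha p beta W j i z z' q = potential j i q z' - potential j i q z.
Proof.
rewrite /potential -mulrBr -sumrB; case: i; rewrite /psi /field;
by congr (_ * _); apply: eq_bigr => x _; rewrite mulrBl.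
Qed.

Definition conductance j i q (z z' : 'I_K) : R :=
  expR (- Num.max (potential j i q z) (potential j i q z')) * adj E z z'.

(** Detailed balance: since (U' - U)^+ = max(U, U') - U, the rate is a weight symmetric in [z] and
    [z'] times exp(U), and [gibbs_ratio] absorbs the last factor. *)
Lemma mul_offdiag_rate j i q z z' :
  q j i 0 z * offdiag_rate alpha p beta W E j i q z z' =
  conductance j i q z z' * gibbs_ratio j i q z.
Proof.
rewrite /offdiag_rate /conductance /gibbs_ratio psiE.
set U := potential j i q z; set U' := potential j i q z'.
have -> : - Num.max (U' - U) 0 = - Num.max U U' + U.
  by rewrite -[0](subrr U) -addr_maxl maxC opprD opprK.
by rewrite expRD; ring.
Qed.

(** The diagonal entry subtracts the outflow of [z'] from its inflow; symmetry of [conductance]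
    merges the two into a Laplacian. *)
Lemma mul_rate_matrix j i q z' : symmetric E ->
  (q j i *m rate_matrix alpha p beta W E j i q) 0 z' =
  \sum_z conductance j i q z z' * (gibbs_ratio j i q z - gibbs_ratio j i q z').
Proof.
move=> Esym; rewrite mxE (bigD1 z') //= [RHS](bigD1 z') //= subrr mulr0 add0r.
rewrite !mxE eqxx mulrN mulr_sumr -sumrN -big_split; apply: eq_bigr => z zz'.
rewrite mxE (negbTE zz') !mul_offdiag_rate mulrBr addrC.
by rewrite /conductance maxC /adj Esym.
Qed.

(** The system is nonlinear in [q], but once [q] is given the conductances are fixed positive edge
    weights, and [harmonic_const] applies to each block separately. *)
Lemma fixed_pointE q : symmetric E -> irreducible_graph E ->
  fixed_point alpha p beta W E q <->
  forall j i z z', gibbs_ratio j i q z = gibbs_ratio j i q z'.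
Proof.
move=> Esym Eirr; split=> [fixq j i|gibbs j i].
  apply: (harmonic_const (S := conductance j i q) _ _ _ Eirr) => [z z'|z z'|z z'|z'].
  - by rewrite mulr_ge0 ?expR_ge0 // /adj; case: ifP.
  - by rewrite /conductance maxC /adj Esym.
  - by move=> Ezz'; rewrite /conductance /adj Ezz' mulr1 expR_gt0.
  - by rewrite -mul_rate_matrix // fixq mxE.
apply/rowP => z'; rewrite mul_rate_matrix // mxE; apply: big1 => z _.
by rewrite (gibbs j i z z') subrr mulr0.
Qed.

(** One vanishing coordinate makes the constant density zero, hence the whole block zero, against
    total mass 1. *)
Lemma gibbs_interior q : (forall j i, in_simplex (q j i)) ->
  (forall j i z z', gibbs_ratio j i q z = gibbs_ratio j i q z') ->
  forall j i, in_simplex_interior (q j i).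
Proof.
move=> hq gibbs j i; split=> // z; have [q_ge0 q_sum1] := hq j i.
rewrite lt_neqAle q_ge0 andbT eq_sym; apply/eqP => qz0.
have q0 y : q j i 0 y = 0.
  apply/eqP; have := gibbs j i y z; rewrite /gibbs_ratio qz0 mul0r => /eqP.
  by rewrite mulf_eq0 (gt_eqF (expR_gt0 _)) orbF.
by move: q_sum1; rewrite big1 // => /esym/eqP; rewrite oner_eq0.
Qed.

(** * The gradient of [freeF] *)

Definition local_energy j i q (x : 'I_K) : R :=
  alpha j * p j i * (potential j i q x + ln (q j i 0 x) + 1).

(** Working along an arbitrary curve keeps the computation bilinear, free of case distinctions on
    coordinates. The factor 1/2 is offset because each product is differentiated in both factors and
    [W] is symmetric. *)
Lemma is_derive_freeF (C : R) (Q : R -> state R K r) (D : state R K r) (t : R) :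
  (forall z z', W z z' = W z' z) ->
  (forall j i x, is_derive t 1 (fun s => Q s j i 0 x) (D j i 0 x)) ->
  (forall j i x, 0 < Q t j i 0 x) ->
  is_derive t 1 (fun s => freeF alpha p beta W C (Q s))
    (\sum_(j < r) \sum_(i : kind) \sum_(x < K) local_energy j i (Q t) x * D j i 0 x).
Proof.
move=> hW QD Qpos; rewrite /freeF.
have BD j i k l : is_derive t 1 (fun s => bilin W (Q s j i 0) (Q s k l 0))
   (bilin W (D j i 0) (Q t k l 0) + bilin W (Q t j i 0) (D k l 0)).
  by apply: is_derive_bilin => z; exact: QD.
have LD j i : is_derive t 1 (fun s => \sum_(z < K) Q s j i 0 z * ln (Q s j i 0 z))
   (\sum_(z < K) (ln (Q t j i 0 z) + 1) * D j i 0 z).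
  by apply: is_derive_fsum => z; exact: is_derive_xlnx.
have quadd j := is_derive_scale (beta / 2) (is_derive_fadd (is_derive_fadd
  (is_derive_scale ((alpha j * p j cen) ^+ 2) (BD j cen j cen))
  (is_derive_scale (2 * alpha j ^+ 2 * p j per * p j cen) (BD j per j cen)))
  (is_derive_scale (alpha j * p j per)
    (is_derive_fsum (fun k => is_derive_scale (alpha k * p k per) (BD k per j per))))).
have entd j := is_derive_fadd (is_derive_scale (alpha j * p j cen) (LD j cen))
  (is_derive_scale (alpha j * p j per) (LD j per)).
have Fd := is_derive_fadd (is_derive_fadd (is_derive_fsum quadd) (is_derive_fsum entd))
  (is_derive_cst C t 1).
apply: (is_derive_eq Fd) => {quadd entd Fd BD LD}.
set q := Q t.
have energyE j i : \sum_(x < K) local_energy j i q x * D j i 0 x =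
    alpha j * p j i * (beta * bilin W (field j i q) (D j i 0)
      + \sum_(x < K) (ln (q j i 0 x) + 1) * D j i 0 x).
  rewrite /bilin [in RHS]mulr_sumr -big_split mulr_sumr; apply: eq_bigr => x _ /=.
  rewrite /local_energy /potential -mulr_suml.
  rewrite (eq_bigr (fun y => W x y * field j i q y)); last by move=> y _; rewrite hW.
  by ring.
(* The peripheral coupling links different blocks: [S1] differentiates its factor [k], [S2] its
   factor [j]. They need not agree for a single [j]; their weighted sums over [j] do. *)
pose S1 j := \sum_k alpha k * p k per * bilin W (D k per 0) (q j per 0).
pose S2 j := \sum_k alpha k * p k per * bilin W (q k per 0) (D j per 0).
have cross : \sum_j alpha j * p j per * S1 j = \sum_j alpha j * p j per * S2 j.
  under eq_bigr do rewrite mulr_sumr.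
  under [RHS]eq_bigr do rewrite mulr_sumr.
  rewrite exchange_big; apply: eq_bigr => j _; apply: eq_bigr => k _.
  by rewrite bilinC // mulrCA.
under [in RHS]eq_bigr do rewrite big_kind !energyE.
have fieldc j d : bilin W (field j cen q) d =
    alpha j * p j cen * bilin W (q j cen 0) d + alpha j * p j per * bilin W (q j per 0) d.
  by rewrite -!bilinZl -bilinDl.
have fieldp j d : bilin W (field j per q) d = alpha j * p j cen * bilin W (q j cen 0) d
    + \sum_k alpha k * p k per * bilin W (q k per 0) d.
  rewrite -bilinZl; under eq_bigr do rewrite -bilinZl.
  by rewrite -bilin_suml -bilinDl.
rewrite addr0 -big_split /=; apply/eqP; rewrite -subr_eq0 -sumrB; apply/eqP.
(* All other terms cancel for each [j] separately. *)
transitivity (\sum_j beta / 2 * (alpha j * p j per * S1 j - alpha j * p j per * S2 j)).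
  apply: eq_bigr => j _; rewrite fieldc fieldp -/(S2 j).
  rewrite (bilinC (D j cen 0) (q j cen 0)) // (bilinC (D j per 0) (q j cen 0)) //.
  set S12 := \sum_(k < r) _ * (_ + _); have -> : S12 = S1 j + S2 j.
    by rewrite -big_split; apply: eq_bigr => k _; rewrite mulrDr.
  by field.
by rewrite -mulr_sumr sumrB cross subrr mulr0.
Qed.

(** A standard basis vector: the velocity of a coordinate line in [partial_freeF], and the building
    block of test directions in [sum_H0_eq0]. *)
Definition unit_state j i x : state R K r := set_coord (fun _ _ => 0) j i x 1.

Lemma unit_stateE j i x j' i' x' :
  unit_state j i x j' i' 0 x' = if [&& j' == j, i' == i & x' == x] then 1 else 0.
Proof. by rewrite mxE mxE. Qed.

Lemma sum_unit_state (G : 'I_r -> kind -> 'I_K -> R) j i x :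
  \sum_(j' < r) \sum_(i' : kind) \sum_(x' < K) G j' i' x' * unit_state j i x j' i' 0 x'
  = G j i x.
Proof.
rewrite (bigD1 j) //= (bigD1 i) //= (bigD1 x) //= unit_stateE !eqxx mulr1.
rewrite big1 => [|x' /negbTE xx']; last by rewrite unit_stateE xx' !andbF mulr0.
rewrite big1 => [|i' /negbTE ii']; last first.
  by apply: big1 => x' _; rewrite unit_stateE ii' andbF mulr0.
rewrite big1 ?addr0 // => j' /negbTE jj'.
by apply: big1 => i' _; apply: big1 => x' _; rewrite unit_stateE jj' mulr0.
Qed.

Lemma partial_freeF (C : R) q j i x :
  (forall z z', W z z' = W z' z) -> (forall j i x, 0 < q j i 0 x) ->
  partial (freeF alpha p beta W C) j i x q = local_energy j i q x.
Proof.
move=> hW qpos; rewrite /partial derive1E.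
have Qt : set_coord q j i x (q j i 0 x) = q.
  apply/funext => j'; apply/funext => i'; apply/rowP => x'; rewrite mxE.
  by case: ifP => // /and3P[/eqP-> /eqP-> /eqP->].
have QD j' i' x' : is_derive (q j i 0 x) 1 (fun s => set_coord q j i x s j' i' 0 x')
    (unit_state j i x j' i' 0 x').
  rewrite unit_stateE; under eq_fun do rewrite mxE.
  by case: ifP => _; [exact: is_derive_id | exact: is_derive_cst].
have := is_derive_freeF C hW QD; rewrite Qt => /(_ qpos) Fd.
by rewrite derive_val sum_unit_state.
Qed.

(** Differences of two basis vectors of the same block lie in H^0 and compare two values of [G];
    conversely a blockwise constant factors out of a zero sum. *)
Lemma sum_H0_eq0 (G : 'I_r -> kind -> 'I_K -> R) : (0 < K)%N ->
  (forall v, in_H0 v -> \sum_(j < r) \sum_(i : kind) \sum_(x < K) G j i x * v j i 0 x = 0)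
  <-> forall j i x x', G j i x = G j i x'.
Proof.
move=> hK; split=> [G0 j i x x'|Gconst v v0]; last first.
  apply: big1 => j _; apply: big1 => i _.
  (* [Ordinal hK] is a reference point at which the constant value is read off. *)
  under eq_bigr do rewrite (Gconst j i _ (Ordinal hK)).
  by rewrite -mulr_sumr v0 mulr0.
have rowsum y j' i' : \sum_(y' < K) unit_state j i y j' i' 0 y' =
    if (j' == j) && (i' == i) then 1 else 0.
  rewrite (bigD1 y) //= big1 => [|y' /negbTE yy']; last first.
    by rewrite unit_stateE yy' !andbF.
  by rewrite unit_stateE eqxx andbT addr0.
apply/eqP; rewrite -subr_eq0; apply/eqP.
rewrite -(sum_unit_state G j i x) -(sum_unit_state G j i x') -sumrB.
rewrite -[RHS](G0 (fun j' i' => unit_state j i x j' i' - unit_state j i x' j' i')).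
  apply: eq_bigr => j' _; rewrite -sumrB; apply: eq_bigr => i' _.
  by rewrite -sumrB; apply: eq_bigr => y _; rewrite !mxE mulrBr.
move=> j' i'; under eq_bigr do rewrite mxE [X in _ + X]mxE.
by rewrite sumrB !rowsum subrr.
Qed.

(** At positive coordinates [gibbs_ratio] is the exponential of potential plus log-density, and
    [expR] is injective. *)
Lemma local_energy_const q j i : 0 < alpha j * p j i -> (forall z, 0 < q j i 0 z) ->
  (forall z z', local_energy j i q z = local_energy j i q z') <->
  (forall z z', gibbs_ratio j i q z = gibbs_ratio j i q z').
Proof.
move=> ap_gt0 qpos.
have gibbsE z : gibbs_ratio j i q z = expR (potential j i q z + ln (q j i 0 z)).
  by rewrite expRD lnK ?posrE // mulrC.
split=> const z z'; have := const z z'.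
  by rewrite !gibbsE => /(mulfI (lt0r_neq0 ap_gt0)) /addIr ->.
by rewrite !gibbsE /local_energy => /expR_inj ->.
Qed.

End MeanField.

Theorem lemma3p1 (R : realType) (K r : nat) (hK : (0 < K)%N) (hr : (0 < r)%N)
    (alpha : 'I_r -> R) (p : 'I_r -> kind -> R) (beta C : R)
    (W : 'I_K -> 'I_K -> R) (E : rel 'I_K)
    (halpha : forall j, 0 < alpha j < 1)
    (hp : forall j i, 0 < p j i < 1)
    (hp_sum : forall j, p j cen + p j per = 1)
    (halpha_sum : \sum_(j < r) alpha j = 1)
    (hbeta : 0 < beta)
    (hW : forall z z', W z z' = W z' z)
    (hE_irrefl : irreflexive E)
    (hE_sym : symmetric E)
    (hE_irred : irreducible_graph E)
    (q : state R K r)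
    (hq : forall j i, in_simplex (q j i)) :
  fixed_point alpha p beta W E q
  <->
  (forall j i, in_simplex_interior (q j i)) /\
  (forall v : state R K r, in_H0 v ->
     dir_deriv (freeF alpha p beta W C) v q = 0).
Proof.
have ap_gt0 j i : 0 < alpha j * p j i.
  by have /andP[? _] := halpha j; have /andP[? _] := hp j i; exact: mulr_gt0.
rewrite fixed_pointE //.
(* The gradient formula is available at positive coordinates. Interiority is assumed in one
   direction of the theorem and comes from [gibbs_interior] in the other. *)
have dirE : (forall j i, in_simplex_interior (q j i)) ->
    (forall v : state R K r, in_H0 v -> dir_deriv (freeF alpha p beta W C) v q = 0) <->
    forall j i z z', gibbs_ratio alpha p beta W j i q z = gibbs_ratio alpha p beta W j i q z'.
  move=> qint; have qpos j i x : 0 < q j i 0 x by have [_] := qint j i.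
  rewrite /dir_deriv; have <- : (forall j i z z',
      local_energy alpha p beta W j i q z = local_energy alpha p beta W j i q z') <->
    forall j i z z', gibbs_ratio alpha p beta W j i q z = gibbs_ratio alpha p beta W j i q z'.
    by split=> h j i; apply/local_energy_const.
  rewrite -(sum_H0_eq0 _ hK).
  have sumE (v : state R K r) : \sum_(j < r) \sum_i \sum_(x < K)
      partial (freeF alpha p beta W C) j i x q * v j i 0 x =
    \sum_(j < r) \sum_i \sum_(x < K) local_energy alpha p beta W j i q x * v j i 0 x.
    apply: eq_bigr => j _; apply: eq_bigr => i _; apply: eq_bigr => x _.
    by rewrite partial_freeF.
  by split=> h v v0; have := h v v0; rewrite sumE.
split=> [gibbs|[qint /(dirE qint)//]].
have qint := gibbs_interior hq gibbs.
by split=> //; apply/(dirE qint).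
Qed.
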